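(* Let $K \subset \mathbb{R}^m$ be a full-dimensional closed convex cone, $C \subset \mathbb{R}^n$ a convex body (compact, convex, with the origin in its interior), $G \subseteq \mathrm{GL}_n$ a group acting on $\mathrm{ext}(C)$, and $H \subseteq \mathrm{GL}_m$ a group acting on $K$. If $C$ has a proper $(G,H)$-symmetric $K$-lift, then the slack operator $S_C$ has a $(G,H)$-symmetric $K$-factorization. Conversely, if $S_C$ has a $(G,H)$-symmetric $K$-factorization, then $C$ has a $(G,H)$-symmetric $K$-lift.
   Context: The polar of $C$ is $C^\circ = \{y \in \mathbb{R}^n : \langle x,y\rangle \le 1 \ \forall x \in C\}$; $\mathrm{ext}(C)$ is the set of extreme points of $C$; the dual cone is $K^* = \{y \in \mathbb{R}^m : \langle x,y\rangle \ge 0 \ \forall x \in K\}$. The slack operator $S_C : \mathrm{ext}(C) \times \mathrm{ext}(C^\circ) \to \mathbb{R}$ is $S_C(x,y) = 1 - \langle x,y\rangle$. A $K$-lift of $C$ is a set $K \cap L$, with $L \subset \mathbb{R}^m$ an affine subspace, together with a linear map $\pi : \mathbb{R}^m \to \mathbb{R}^n$ such that $C = \pi(K\cap L)$; it is proper if $L$ meets the interior of $K$. A $K$-factorization of $S_C$ is a pair of maps $A : \mathrm{ext}(C) \to K$, $B : \mathrm{ext}(C^\circ) \to K^*$ (not necessarily linear) with $S_C(x,y) = \langle A(x),B(y)\rangle$ for all $(x,y) \in \mathrm{ext}(C)\times\mathrm{ext}(C^\circ)$. The elements of $G$ are linear maps of $\mathbb{R}^n$ that map $\mathrm{ext}(C)$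 onto itself, and the elements of $H$ are linear maps of $\mathbb{R}^m$ that map $K$ onto itself. The groups $G$ are taken to be compact (and so have a normalized Haar measure). The lift $K \cap L$ (with map $\pi$) is $(G,H)$-symmetric if there exists a group homomorphism from $G$ to $H$, sending $\varphi \in G$ to $f_\varphi \in H$, such that $f_\varphi(K\cap L) = K \cap L$ and $\pi \circ f_\varphi = \varphi\circ\pi$ when restricted to $K \cap L \cap \pi^{-1}(\mathrm{ext}(C))$, for all $\varphi \in G$. A $K$-factorization $A,B$ of $S_C$ is $(G,H)$-symmetric if there exists a group homomorphism from $G$ to $H$, sending $\varphi \in G$ to $f_\varphi \in H$, such that $A \circ \varphi = f_\varphi \circ A$ for all $\varphi \in G$.
   Formalization: In the first implication the group homomorphism from G to H is required to be continuous (and the one obtained is continuous), since the claim fails for discontinuous homomorphisms; n ≥ 1 is assumed. The converse is for arbitrary homomorphisms, and also for continuous ones. *)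

(* Defs.v *)
From HB Require Import structures.
From mathcomp Require Import all_boot all_order all_algebra.
From mathcomp Require Import all_classical all_reals all_analysis.

Set Implicit Arguments.
Unset Strict Implicit.
Unset Printing Implicit Defensive.

Import Order.TTheory GRing.Theory Num.Theory.
Import numFieldNormedType.Exports.

Local Open Scope classical_set_scope.
Local Open Scope ring_scope.

(* Points of R^n are column vectors, linear maps R^m -> R^n are n x m matrices
   acting on the left, and subgroups of GL_n are sets of invertible matrices.
   The sup norm that the library puts on matrices induces the usual topology. *)

Section Convex.
Variables (R : realType) (n : nat).
Implicit Types (C K L : set 'cV[R]_n) (x y : 'cV[R]_n).

Definition dotp x y : R := \sum_(i < n) x i 0 * y i 0.

Definition polar C : set 'cV[R]_n :=
  [set y | forall x, C x -> dotp x y <= 1].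

Definition dual_cone K : set 'cV[R]_n :=
  [set y | forall x, K x -> 0 <= dotp x y].

Definition ext C : set 'cV[R]_n :=
  [set x | C x /\ forall (a b : 'cV[R]_n) (t : R), C a -> C b -> 0 < t < 1 ->
     x = t *: a + (1 - t) *: b -> a = x /\ b = x].

Definition convex_body C : Prop :=
  [/\ compact C, convex_set C & interior C 0].

Definition closed_convex_cone K : Prop :=
  [/\ closed K, convex_set K, K 0 &
      forall (t : R) x, 0 <= t -> K x -> K (t *: x)].

Definition full_dimensional K : Prop := interior K !=set0.

Definition affine_subspace L : Prop :=
  exists (p : 'cV[R]_n) (U : {vspace 'cV[R]_n}), L = [set p + u | u in [set` U]].

Definition slack x y : R := 1 - dotp x y.

Definition matrix_group (G : set 'M[R]_n) : Prop :=
  [/\ forall g, G g -> g \in unitmx,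
      G 1%:M,
      forall g h, G g -> G h -> G (g *m h) &
      forall g, G g -> G (invmx g)].

Definition acts_on (G : set 'M[R]_n) (X : set 'cV[R]_n) : Prop :=
  forall g, G g -> [set g *m x | x in X] = X.

End Convex.

Section Lifts.
Variables (R : realType) (n m : nat).
Implicit Types (C : set 'cV[R]_n) (K L : set 'cV[R]_m) (P : 'M[R]_(n, m)).
Implicit Types (G : set 'M[R]_n) (H : set 'M[R]_m).

Definition is_lift C K L P : Prop :=
  affine_subspace L /\ C = [set P *m w | w in K `&` L].

Definition proper_lift K L : Prop := (L `&` interior K) !=set0.

Definition is_factorization C K
    (A : 'cV[R]_n -> 'cV[R]_m) (B : 'cV[R]_n -> 'cV[R]_m) : Prop :=
  [/\ forall x, ext C x -> K (A x),
      forall y, ext (polar C) y -> dual_cone K (B y) &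
      forall x y, ext C x -> ext (polar C) y -> slack x y = dotp (A x) (B y)].

(* Only the values of f on G matter. *)
Definition group_hom G H : set ('M[R]_n -> 'M[R]_m) :=
  [set f | (forall g, G g -> H (f g)) /\
           (forall g h, G g -> G h -> f (g *m h) = f g *m f h)].

(* Homomorphisms of topological groups, for which integrals over closed
   subgroups of G against Haar measure make sense. *)
Definition continuous_group_hom G H : set ('M[R]_n -> 'M[R]_m) :=
  [set f | group_hom G H f /\ {within G, continuous f}].

(* Symmetry is relative to a class Hom of homomorphisms from G to H, which is
   either group_hom G H or continuous_group_hom G H. *)
Definition symmetric_lift (Hom : set ('M[R]_n -> 'M[R]_m)) G C K L P : Prop :=
  exists2 f, Hom f & forall g, G g ->
    [set f g *m w | w in K `&` L] = K `&` L /\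
    forall w, (K `&` L) w -> ext C (P *m w) -> P *m (f g *m w) = g *m (P *m w).

Definition symmetric_factorization (Hom : set ('M[R]_n -> 'M[R]_m)) G C
    (A : 'cV[R]_n -> 'cV[R]_m) : Prop :=
  exists2 f, Hom f & forall g, G g ->
    forall x, ext C x -> A (g *m x) = f g *m A x.

End Lifts.

(* Main.v *)
Require Import Defs.
From mathcomp Require Import all_boot all_order all_algebra.
From mathcomp Require Import all_classical all_reals all_analysis.
From mathcomp Require Import ring lra.

(* From a factorization (A, B), only the equivariant map A is needed to build
   the lift: L consists of the affine combinations of the points A x, and it is
   stable under every f g because f g permutes them. Since 1 - <x, y> =
   <A x, B y> and the extreme points of the polar determine x, A x |-> x extends
   to a linear map P, and w in K with P w outside C would pair negatively with
   some B y. That C is covered is Minkowski's theorem.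

   From a proper lift, B comes from extending the affine slack functional on L
   to a linear functional that is nonnegative on K (M. Riesz extension, where
   properness is used). The equivariant section A does not require averaging
   against Haar measure: v |-> sup_g |f g v|^2 is invariant and strictly convex
   by compactness of G, so it has a unique minimizer A x on the fiber of x, and
   f g maps the minimizer over x to the minimizer over g x. *)

Import Order.TTheory GRing.Theory Num.Theory.
Import numFieldNormedType.Exports.

Local Open Scope classical_set_scope.
Local Open Scope ring_scope.

Set Implicit Arguments.
Unset Strict Implicit.
Unset Printing Implicit Defensive.

(** * Linear algebra and the dot product *)

Section LinearAlgebra.

Lemma span_ind (F : fieldType) (V : vectType F) (S : set V) (X : seq V) :
  S 0 -> (forall a u v, S u -> S v -> S (a *: u + v)) ->
  (forall v, v \in X -> S v) -> forall v, v \in <<X>>%VS -> S v.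
Proof.
move=> S0 Slin SX v vX.
rewrite (coord_span (X := in_tuple X) vX).
elim/big_rec : _ => // i u _ Su; apply: Slin => //.
exact/SX/mem_nth.
Qed.

(** A free family in [S] of maximal size spans [S]; its size is bounded by the dimension of [V]. *)
Lemma free_spanning (F : fieldType) (V : vectType F) (S : set V) :
  exists X : seq V,
    [/\ free X, forall v, v \in X -> S v & forall v, S v -> v \in <<X>>%VS].
Proof.
pose p k := `[< exists X : seq V,
  [/\ free X, forall v, v \in X -> S v & size X = k] >].
have p0 : exists k, p k by exists 0%N; apply/asboolP; exists [::]; rewrite nil_free.
have pbnd k : p k -> (k <= \dim {:V})%N.
  move=> /asboolP[X [fX _ <-]].
  by rewrite -(eqP fX) dimvS// subvf.
case: (ex_maxnP p0 pbnd) => k /asboolP[X [fX XS sX]] kmax.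
exists X; split => // v Sv; apply/negPn/negP => vX.
suff /kmax : p k.+1 by rewrite ltnn.
apply/asboolP; exists (v :: X); split; [|move=> w|by rewrite /= sX].
  by rewrite free_cons vX.
by rewrite inE => /orP[/eqP -> //|/XS].
Qed.

Lemma linear_closed_vspace (F : fieldType) (V : vectType F) (S : set V) :
  S 0 -> (forall a u v, S u -> S v -> S (a *: u + v)) ->
  exists U : {vspace V}, forall v, v \in U <-> S v.
Proof.
move=> S0 Slin; have [X [_ XS SX]] := free_spanning S.
by exists <<X>>%VS => v; split; [exact: span_ind | exact: SX].
Qed.

(** [P] sums the columns [h v] times the coordinate functionals of [X], written as rows. *)
Lemma mulmx_ext_free (F : fieldType) (n m : nat) (X : seq 'cV[F]_m)
    (h : 'cV[F]_m -> 'cV[F]_n) : free X ->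
  exists P : 'M[F]_(n, m), forall v, v \in X -> P *m v = h v.
Proof.
move=> fX; pose T := in_tuple X.
pose P := \sum_(i < size X)
  h T`_i *m \row_j (coord T i (delta_mx j 0) : F).
have PE v : P *m v = \sum_(i < size X) coord T i v *: h T`_i.
  rewrite mulmx_suml; apply: eq_bigr => i _; rewrite -mulmxA.
  rewrite [X in _ *m X](_ : _ = (coord T i v)%:M) ?mul_mx_scalar//.
  apply/matrixP => a b; rewrite !ord1 !mxE mulr1n.
  rewrite [in RHS](matrix_sum_delta v) linear_sum; apply: eq_bigr => j _.
  by rewrite big_ord1 linearZ /= !mxE mulrC.
exists P => v vX.
have iX : (index v X < size X)%N by rewrite index_mem.
rewrite -(nth_index 0 vX) -[index v X]/(val (Ordinal iX)) PE.
rewrite (bigD1 (Ordinal iX))//= [X in _ + X]big1 ?addr0; last first.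
  move=> j ji; rewrite (coord_free (X := T) (Ordinal iX) j)//.
  by rewrite eq_sym (negbTE ji) scale0r.
by rewrite (coord_free (X := T) (Ordinal iX) (Ordinal iX))// eqxx scale1r.
Qed.

End LinearAlgebra.

Section DotProduct.
Variables (R : realType) (n : nat).
Implicit Types x y z : 'cV[R]_n.

Lemma dotpC x y : dotp x y = dotp y x.
Proof. by apply: eq_bigr => i _; rewrite mulrC. Qed.

Lemma dotpDl x y z : dotp (x + y) z = dotp x z + dotp y z.
Proof. by rewrite -big_split; apply: eq_bigr => i _; rewrite mxE mulrDl. Qed.

Lemma dotpZl a x y : dotp (a *: x) y = a * dotp x y.
Proof. by rewrite mulr_sumr; apply: eq_bigr => i _; rewrite mxE mulrA. Qed.

Lemma dotpDr x y z : dotp z (x + y) = dotp z x + dotp z y.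
Proof. by rewrite dotpC dotpDl !(dotpC z). Qed.

Lemma dotpZr a x y : dotp x (a *: y) = a * dotp x y.
Proof. by rewrite dotpC dotpZl dotpC. Qed.

Lemma dotp0l x : dotp 0 x = 0.
Proof. by rewrite -(scale0r 0) dotpZl mul0r. Qed.

Lemma dotp0r x : dotp x 0 = 0. Proof. by rewrite dotpC dotp0l. Qed.

Lemma dotpNl x y : dotp (- x) y = - dotp x y.
Proof. by rewrite -scaleN1r dotpZl mulN1r. Qed.

Lemma dotpNr x y : dotp x (- y) = - dotp x y.
Proof. by rewrite dotpC dotpNl dotpC. Qed.

Definition dotpE := (dotpDl, dotpDr, dotpNl, dotpNr, dotpZl, dotpZr).

Lemma dotp_mulmxl m (P : 'M[R]_(n, m)) (w : 'cV[R]_m) y :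
  dotp (P *m w) y = dotp w (P^T *m y).
Proof.
have E k (a b : 'cV[R]_k) : dotp a b = (a^T *m b) 0 0.
  by rewrite mxE; apply: eq_bigr => i _; rewrite mxE.
by rewrite !E trmx_mul mulmxA.
Qed.

Lemma dotp_ge0 x : 0 <= dotp x x.
Proof. by apply: sumr_ge0 => i _; rewrite -expr2 sqr_ge0. Qed.

Lemma dotp_coord x i : x i 0 ^+ 2 <= dotp x x.
Proof.
rewrite /dotp (bigD1 i)//= -expr2 lerDl.
by apply: sumr_ge0 => j _; rewrite -expr2 sqr_ge0.
Qed.

Lemma dotp_eq0 x : dotp x x = 0 -> x = 0.
Proof.
move=> x0; apply/matrixP => i j; rewrite ord1 mxE; apply/eqP.
by rewrite -sqrf_eq0 eq_le sqr_ge0 andbT -x0 dotp_coord.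
Qed.

Lemma dotp_delta x i : dotp x (delta_mx i 0) = x i 0.
Proof.
rewrite /dotp (bigD1 i)//= big1 ?addr0 ?mxE ?eqxx ?mulr1// => j ji.
by rewrite mxE (negbTE ji) mulr0.
Qed.

Lemma dotp_continuous y : continuous (fun x => dotp x y).
Proof.
rewrite /dotp; apply: (@continuous_big R _ +%R 0 xpredT _ 'cV[R]_n _
  (fun i x => x i 0 * y i 0)) => [|i _]; first exact: add_continuous.
by move=> x; apply: (cvgM (@coord_continuous R n 1 i 0 x)); exact: cvg_cst.
Qed.

(** [v] followed by a basis of [U] is free, so a functional can be prescribed as 1 on [v] and 0 on
    that basis. *)
Lemma vspace_sep (U : {vspace 'cV[R]_n}) v : v \notin U ->
  exists2 y, (forall u, u \in U -> dotp u y = 0) & dotp v y = 1.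
Proof.
move=> vU; have fX : free (v :: vbasis U).
  by rewrite free_cons (span_basis (vbasisP U)) vU (basis_free (vbasisP U)).
have [P PE] := mulmx_ext_free (fun w => (if w == v then 1 else 0) : 'cV[R]_1) fX.
have dE w : dotp w P^T = (P *m w) 0 0.
  by rewrite mxE; apply: eq_bigr => i _; rewrite mxE mulrC.
exists P^T; last first.
  by rewrite dE PE ?mem_head// eqxx mxE eqxx.
move=> u; rewrite -(span_basis (vbasisP U)).
apply: (span_ind (S := [set u | dotp u P^T = 0])) => /=.
- by rewrite dotp0l.
- by move=> a x z x0 z0; rewrite dotpDl dotpZl x0 z0 mulr0 addr0.
- move=> w wU; rewrite dE PE ?inE ?wU ?orbT//; case: eqP => [wv|]; last by rewrite mxE.
  by move: vU; rewrite -wv (vbasis_mem wU).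
Qed.

End DotProduct.

(** * Invariant gauges and their minimizers *)

Section Topology.
Variable R : realType.

Lemma continuous_mx (T : topologicalType) (m n : nat) (f : T -> 'M[R]_(m, n)) :
  (forall i j, continuous (fun x => f x i j)) -> continuous f.
Proof.
move=> fc x A [P fxP PA].
have : \forall y \near x, forall i j, P i j (f y i j).
  by apply: filter_forall => i; apply: filter_forall => j; apply: fc; exact: fxP.
by apply: filterS => y Py; exact: PA.
Qed.

Lemma mulmx_continuousr (m n p : nat) (A : 'M[R]_(m, n)) :
  continuous (fun B : 'M[R]_(n, p) => A *m B).
Proof.
apply: continuous_mx => i j.
rewrite (_ : (fun _ => _) = fun B : 'M[R]_(n, p) => \sum_k A i k * B k j).
  apply: (@continuous_big R _ +%R 0 xpredT _ _ _
    (fun k (B : 'M[R]_(n, p)) => A i k * B k j)) => [|k _].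
    exact: add_continuous.
  by move=> B; exact: (cvgM (cvg_cst _) (@coord_continuous R n p k j B)).
by apply/funext => B; rewrite mxE.
Qed.

Lemma trmx_continuous (m n : nat) : continuous (@trmx R m n).
Proof.
apply: continuous_mx => i j; rewrite (_ : (fun _ => _) = fun B : 'M[R]_(m, n) => B j i).
  exact: (@coord_continuous R m n j i).
by apply/funext => B; rewrite mxE.
Qed.

Lemma mulmx_continuousl (m n p : nat) (B : 'M[R]_(n, p)) :
  continuous (fun A : 'M[R]_(m, n) => A *m B).
Proof.
rewrite (_ : (fun _ => _) = fun A : 'M[R]_(m, n) => (B^T *m A^T)^T); last first.
  by apply/funext => A; rewrite trmx_mul !trmxK.
move=> A; apply: (@continuous_comp _ _ _ (fun A : 'M[R]_(m, n) => B^T *m A^T)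
  (@trmx R _ _)); last exact: trmx_continuous.
apply: (@continuous_comp _ _ _ (@trmx R m n) (mulmx B^T)).
  exact: trmx_continuous.
exact: mulmx_continuousr.
Qed.

Lemma normsq_continuous (n : nat) : continuous (fun x : 'cV[R]_n => dotp x x).
Proof.
rewrite /dotp; apply: (@continuous_big R _ +%R 0 xpredT _ 'cV[R]_n _
  (fun i x => x i 0 * x i 0)) => [|i _]; first exact: add_continuous.
by move=> x; exact: cvgM (@coord_continuous R n 1 i 0 x)
                         (@coord_continuous R n 1 i 0 x).
Qed.

Lemma closed_preimage (T U : topologicalType) (f : T -> U) (D : set U) :
  continuous f -> closed D -> closed (f @^-1` D).
Proof. by move=> /continuous_closedP; exact. Qed.

Lemma compact_cV (n : nat) (S : set 'cV[R]_n) (M : R) :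
  closed S -> (forall x, S x -> dotp x x <= M) -> compact S.
Proof.
move=> cS bS.
have -> : S = @trmx R _ _ @` (@trmx R 1 n @^-1` S).
  apply/seteqP; split => [x Sx|_ [y /= Sy <-]//].
  by exists x^T; rewrite /= trmxK.
apply: continuous_compact; first exact/continuous_subspaceT/trmx_continuous.
apply: bounded_closed_compact; last exact: closed_preimage (@trmx_continuous _ _) cS.
(* Any [t] beyond [1 + M] has [M <= t ^+ 2], which dominates the square of every entry. *)
exists (1 + M); split; first exact: num_real.
move=> t Mt y /= /bS yM; rewrite [leLHS]/Num.norm /= mx_normrE.
have M0 : 0 <= M by apply: le_trans yM; exact: dotp_ge0.
have t0 : 1 <= t by lra.
apply/bigmax_leP; split => /=; first by lra.
move=> [i j] _ /=; rewrite ord1 -(@ler_pXn2r _ 2) ?nnegrE//; last by lra.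
have := dotp_coord y^T j; rewrite mxE real_normK ?num_real// => h.
have : t * 1 <= t * t by rewrite ler_pM2l; lra.
rewrite expr2; lra.
Qed.

Lemma cluster_closed (T : topologicalType) (F : set_system T) (A : set T) x :
  closed A -> F A -> cluster F x -> A x.
Proof. by move=> cA FA Fx; apply: cA => B xB; exact: Fx FA xB. Qed.

(** Coercivity makes the sets of near-minimizers bounded, hence compact; a cluster point of the
    filter they generate lies in all of them. *)
Lemma closed_minimizer (n : nat) (phi : 'cV[R]_n -> R) (F : set 'cV[R]_n) :
  (forall c, closed [set x | phi x <= c]) ->
  (forall x, dotp x x <= phi x) ->
  closed F -> F !=set0 -> exists2 x, F x & forall y, F y -> phi x <= phi y.
Proof.
move=> lsc coer cF [x0 Fx0]; pose I := inf (phi @` F).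
have lbI : has_lbound (phi @` F).
  by exists 0 => _ [y _ <-]; apply: le_trans (coer y); exact: dotp_ge0.
have infI : has_inf (phi @` F) by split => //; exists (phi x0); exists x0.
pose B e := F `&` [set x | phi x <= I + e].
have cB e : closed (B e) by apply: closedI => //; exact: lsc.
have B0 e : 0 < e -> B e !=set0.
  move=> e0; have [_ [y Fy <-] /ltW ye] := inf_adherent e0 infI.
  by exists y.
pose U := filter_from [set e : R | 0 < e] B.
have UF : ProperFilter U.
  apply: filter_from_proper; last by move=> e /B0.
  apply: filter_from_filter; first by exists 1; rewrite /= ltr01.
  move=> e1 e2 /= e10 e20; exists (Order.min e1 e2).
    by rewrite /= lt_min e10.
  move=> x [Fx /= xe]; split; split => //=; apply: (le_trans xe).
    by rewrite lerD2l ge_min lexx.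
  by rewrite lerD2l ge_min lexx orbT.
have UB e : 0 < e -> U (B e) by move=> e0; exists e.
have [] := @compact_cV n (B 1) (I + 1) (cB 1) _ U UF (UB _ ltr01).
  by move=> x [_ /=]; exact/le_trans/coer.
move=> x [[Fx _] xU]; exists x => // y Fy.
apply: (@le_trans _ _ I); last by apply: ge_inf => //; exists y.
apply/ler_addgt0Pr => e e0.
by have [] := cluster_closed (cB e) (UB _ e0) xU.
Qed.

End Topology.

(** * Orbit gauges: existence and uniqueness of minimizers *)

Section Gauge.
Variables (R : realType) (m : nat).
Implicit Types (E : set 'M[R]_m) (v w : 'cV[R]_m).

Definition gauge E v : R := sup [set dotp (M *m v) (M *m v) | M in E].

Lemma gauge_has_sup E v : E 1%:M -> compact E ->
  has_sup [set dotp (M *m v) (M *m v) | M in E].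
Proof.
move=> E1 cE; apply: compact_has_sup.
  by exists (dotp (1%:M *m v) (1%:M *m v)); exists 1%:M.
apply: continuous_compact => //; apply: continuous_subspaceT => M.
apply: (@continuous_comp _ _ _ (fun M : 'M[R]_m => M *m v) (fun x => dotp x x)).
  exact: mulmx_continuousl.
exact: normsq_continuous.
Qed.

Lemma gauge_ub E M v : E 1%:M -> compact E -> E M ->
  dotp (M *m v) (M *m v) <= gauge E v.
Proof.
move=> E1 cE EM; apply: sup_upper_bound; first exact: gauge_has_sup.
by exists M.
Qed.

Lemma gauge_attained E v : E 1%:M -> compact E ->
  exists2 M, E M & gauge E v = dotp (M *m v) (M *m v).
Proof.
move=> E1 cE.
have [] := @compact_EVT_max _ R (fun M : 'M[R]_m => dotp (M *m v) (M *m v)) E _ cE.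
- by exists 1%:M.
- apply: continuous_subspaceT => M.
  apply: (@continuous_comp _ _ _ (fun M : 'M[R]_m => M *m v) (fun x => dotp x x)).
    exact: mulmx_continuousl.
  exact: normsq_continuous.
move=> M /set_mem EM Mmax; exists M => //; apply/eqP.
rewrite eq_le gauge_ub// andbT; apply: ge_sup.
  by exists (dotp (1%:M *m v) (1%:M *m v)); exists 1%:M.
by move=> _ [N EN <-]; exact/Mmax/mem_set.
Qed.

Lemma gauge_le E v c : E 1%:M -> compact E ->
  (gauge E v <= c) <-> (forall M, E M -> dotp (M *m v) (M *m v) <= c).
Proof.
move=> E1 cE; split => [vc M EM|vc]; first by apply: le_trans vc; exact: gauge_ub.
by have [M EM ->] := gauge_attained v E1 cE; exact: vc.
Qed.

(** Sublevel sets are closed as intersections over [E], and the identity in [E] makes the gauge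
    dominate the squared norm. *)
Lemma gauge_argmin E (F : set 'cV[R]_m) : E 1%:M -> compact E ->
  closed F -> F !=set0 -> exists2 v, F v & forall w, F w -> gauge E v <= gauge E w.
Proof.
move=> E1 cE; apply: closed_minimizer => [c|v]; last first.
  by have := gauge_ub v E1 cE E1; rewrite mul1mx.
rewrite (_ : [set _ | _] =
    \bigcap_(M in E) [set v | dotp (M *m v) (M *m v) <= c]); last first.
  by apply/seteqP; split => v /=; rewrite gauge_le.
apply: closed_bigI => M EM.
apply: (@closed_preimage _ _ (fun v : 'cV[R]_m => dotp (M *m v) (M *m v))
  [set r | r <= c]); last exact: closed_le.
move=> v.
apply: (@continuous_comp _ _ _ (fun v : 'cV[R]_m => M *m v) (fun x => dotp x x)).
  exact: mulmx_continuousr.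
exact: normsq_continuous.
Qed.

(* The parallelogram identity at a matrix where the gauge of the midpoint is
   attained makes the gauge strictly convex. *)
Lemma gauge_argmin_uniq E (F : set 'cV[R]_m) v w : E 1%:M -> compact E ->
  (forall M, E M -> M \in unitmx) ->
  F (2^-1 *: (v + w)) ->
  (forall u, F u -> gauge E v <= gauge E u) ->
  (forall u, F u -> gauge E w <= gauge E u) -> v = w.
Proof.
move=> E1 cE uE Fvw vmin wmin; apply/eqP; rewrite -subr_eq0; apply/eqP.
have [M EM Me] := gauge_attained (2^-1 *: (v + w)) E1 cE.
have := vmin _ Fvw; have := wmin _ Fvw; rewrite Me.
have := gauge_ub v E1 cE EM; have := gauge_ub w E1 cE EM.
rewrite -scalemxAr mulmxDr !dotpE.
set a := M *m v; set b := M *m w; rewrite (dotpC b a) => bw av hw hv.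
have : dotp (a - b) (a - b) = 0.
  apply/eqP; rewrite eq_le dotp_ge0 andbT.
  rewrite !dotpE (dotpC b a); nra.
move=> /dotp_eq0; rewrite /a /b -mulmxBr => /(congr1 (mulmx (invmx M))).
by rewrite mulKmx ?uE// mulmx0.
Qed.

End Gauge.

(** * Convex bodies, polars and cones *)

Section Convexity.
Variables (R : realType) (n : nat).
Implicit Types (C D K S : set 'cV[R]_n) (x y d : 'cV[R]_n).

Lemma convex_setP C : convex_set C <->
  forall a b t, C a -> C b -> 0 <= t <= 1 -> C (t *: a + (1 - t) *: b).
Proof.
split=> [cC a b t Ca Cb /andP[t0 t1]|cC a b t /set_mem Ca /set_mem Cb].
  have := cC a b (Itv01 t0 t1) (mem_set Ca) (mem_set Cb).
  by move/set_mem.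
by apply/mem_set; apply: cC => //; rewrite ge0 le1.
Qed.

Lemma convex_combination C x y (s t : R) : convex_set C -> 0 <= s -> 0 <= t ->
  0 < s + t -> C x -> C y -> C ((s + t)^-1 *: (s *: x + t *: y)).
Proof.
move=> /convex_setP cC s0 t0 st0 Cx Cy.
have -> : (s + t)^-1 *: (s *: x + t *: y) =
    (s / (s + t)) *: x + (1 - s / (s + t)) *: y.
  rewrite scalerDr !scalerA [_^-1 * s]mulrC; congr (_ + _ *: _).
  by field; rewrite gt_eqF.
apply: cC => //; rewrite divr_ge0 ?addr_ge0//= ler_pdivrMr// mul1r.
by rewrite lerDl.
Qed.

Lemma interior_direction C x d : interior C x ->
  exists2 t, 0 < t & C (x + t *: d).
Proof.
move=> Cx; have : (fun t : R => x + t *: d) @ (0 : R) --> x + (0 : R) *: d.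
  apply: cvgD; first exact: cvg_cst.
  by apply: cvgZr_tmp; exact: cvg_id.
rewrite scale0r addr0 => /(_ _ Cx) /nbhs_ballP[e /= e0 eC].
exists (e / 2); first by lra.
by apply: eC; rewrite /ball /= sub0r normrN gtr0_norm; lra.
Qed.

Lemma interior_directions C x d : convex_set C -> interior C x ->
  exists2 t, 0 < t & C (x + t *: d) /\ C (x - t *: d).
Proof.
move=> /convex_setP cC Cx.
have [s s0 Cs] := interior_direction d Cx.
have [t t0 Ct] := interior_direction (- d) Cx.
have Cx0 := interior_subset Cx.
(* Points of [C] can be pulled back towards [x], so the smaller of the two step lengths serves both
   signs. *)
have shrink u r e : 0 < r -> 0 <= e <= r -> C (x + r *: u) -> C (x + e *: u).
  move=> r0 /andP[e0 er] Cr.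
  have -> : x + e *: u = (e / r) *: (x + r *: u) + (1 - e / r) *: x.
    rewrite scalerDr scalerA divfK ?gt_eqF// addrAC -scalerDl.
    by rewrite [e / r + _]addrC subrK scale1r.
  by apply: cC => //; rewrite divr_ge0 ?(ltW r0)//= ler_pdivrMr ?mul1r.
exists (Order.min s t); first by rewrite lt_min s0.
rewrite -scalerN; split; [apply: (shrink _ s)|apply: (shrink _ t)] => //.
- by rewrite le_min (ltW s0) (ltW t0) ge_min lexx.
- by rewrite le_min (ltW s0) (ltW t0) ge_min lexx orbT.
Qed.

Lemma farthest_point C x d : closed C -> (exists M, forall x, C x -> dotp x x <= M) ->
  d != 0 -> C x ->
  exists s, [/\ 0 <= s, C (x + s *: d) & forall t, C (x + t *: d) -> t <= s].
Proof.
move=> cC [M CM] d0 Cx; pose I := [set t : R | C (x + t *: d)].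
have I0 : I 0 by rewrite /I /= scale0r addr0.
have d_gt0 : 0 < dotp d d.
  by rewrite lt_neqAle dotp_ge0 andbT eq_sym; apply: contra_neq d0; exact: dotp_eq0.
have cI : closed I.
  apply: (@closed_preimage _ _ (fun t : R => x + t *: d)) => // t.
  by apply: cvgD; [exact: cvg_cst | apply: cvgZr_tmp; exact: cvg_id].
have bI t : I t -> t ^+ 2 * dotp d d <= 2 * M + 2 * dotp x x.
  move=> /CM; rewrite !dotpE (dotpC d x) => h.
  have := dotp_ge0 (2 *: x + t *: d); rewrite !dotpE (dotpC d x); nra.
have sI : has_sup I.
  split; first by exists 0.
  exists (1 + (2 * M + 2 * dotp x x) / dotp d d) => t /bI.
  rewrite -ler_pdivlMr// => h; have := sqr_ge0 (t - 1); move: h; rewrite !expr2; nra.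
exists (sup I); split.
- exact: sup_upper_bound.
- have : closure I (sup I) by apply: closure_sup; [exists 0 | case: sI].
  by move/cI.
- by move=> t It; exact: sup_upper_bound.
Qed.

(** * Extreme points, faces and Minkowski's theorem *)

Lemma ext_intro C x : convex_set C -> C x ->
  (forall d e, 0 < e -> C (x + e *: d) -> C (x - e *: d) -> d = 0) -> ext C x.
Proof.
move=> /convex_setP cC Cx xd; split=> // a b t Ca Cb /andP[t0 t1] xab.
suff ab : a = b by move: xab; rewrite ab -scalerDl [t + _]addrC subrK scale1r => ->.
apply/eqP; rewrite -subr_eq0; apply/eqP.
(* Both [t + e] and [t - e] stay in [0, 1], so a nonzero [a - b] would give a segment of [C] centred
   at [x]. *)
pose e := Order.min t (1 - t).
have e0 : 0 < e by rewrite lt_min t0 subr_gt0.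
have et : e <= t by rewrite ge_min lexx.
have et1 : e <= 1 - t by rewrite ge_min lexx orbT.
apply: (xd _ e) => //.
- have -> : x + e *: (a - b) = (t + e) *: a + (1 - (t + e)) *: b.
    by rewrite xab; apply/matrixP => i j; rewrite !mxE; ring.
  by apply: cC => //; lra.
- have -> : x - e *: (a - b) = (t - e) *: a + (1 - (t - e)) *: b.
    by rewrite xab; apply/matrixP => i j; rewrite !mxE; ring.
  by apply: cC => //; lra.
Qed.

(* The linear span, up to translation, of the face of C that contains x in its
   relative interior. *)
Definition face_directions C x : set 'cV[R]_n :=
  [set d | exists2 e, 0 < e & C (x + e *: d) /\ C (x - e *: d)].

Lemma face_directions_lin C x a u v : convex_set C ->
  face_directions C x u -> face_directions C x v ->
  face_directions C x (a *: u + v).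
Proof.
move=> cC [e e0 [Ce Ce']] [r r0 [Cr Cr']].
have [->|a0] := eqVneq a 0; first by rewrite scale0r add0r; exists r.
have na0 : 0 < `|a| by rewrite normr_gt0.
have [s s1 as1] : exists2 s, s * s = 1 & a = s * `|a|.
  exists (Num.sg a); last by rewrite -numEsg.
  by rewrite -expr2 sqr_sg a0.
have Cse : C (x + (s * e) *: u) /\ C (x - (s * e) *: u).
  have : (s - 1) * (s + 1) = 0.
    rewrite (_ : (s - 1) * (s + 1) = s * s - 1); last by ring.
    by rewrite s1 subrr.
  move=> /eqP; rewrite mulf_eq0 subr_eq0 addr_eq0 => /orP[] /eqP->.
    by rewrite mul1r.
  by rewrite mulN1r scaleNr opprK.
(* This length comes from averaging the points at [e] along [s *: u] and at [r] along [v], with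
   weights [r] and [e] over the absolute value of [a]. *)
exists (((e / `|a|) * r) / (e / `|a| + r)).
  by rewrite !(divr_gt0, mulr_gt0, addr_gt0).
have p0 : 0 < r + e / `|a| by rewrite addr_gt0 ?divr_gt0.
have w (z : R) : C (x + (z * (s * e)) *: u) -> C (x + (z * r) *: v) ->
    C (x + z *: ((e / `|a| * r / (e / `|a| + r)) *: (a *: u + v))).
  move=> Cu Cv.
  have := convex_combination cC (ltW r0) (ltW (divr_gt0 e0 na0)) p0 Cu Cv.
  have -> : a *: u + v = (s * `|a|) *: u + v by rewrite -as1.
  congr C; apply/matrixP => i j; rewrite !mxE. field.
  rewrite !gt_eqF//; have := mulr_gt0 na0 r0; lra.
split; first by have := w 1; rewrite !scale1r !mul1r; case: Cse => + _ => /[swap] /[apply]; exact.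
have := w (-1); rewrite !scaleN1r !mulN1r !scaleNr.
by case: Cse => _ /[swap] /[apply]; exact.
Qed.

(** The homothety centred at [x - t *: d] that sends [x + s *: d] to [x] has ratio [t / (t + s)] and
    maps [C] into itself. *)
Lemma face_directions_sub C x d s t u : convex_set C -> 0 <= s -> 0 < t ->
  C (x - t *: d) -> face_directions C (x + s *: d) u -> face_directions C x u.
Proof.
move=> cC s0 t0 Ct [e e0 [Ce Ce']].
have st0 : 0 < t + s by lra.
exists (t * e / (t + s)); first by rewrite divr_gt0 ?mulr_gt0.
split; [have := convex_combination cC (ltW t0) s0 st0 Ce Ct
       |have := convex_combination cC (ltW t0) s0 st0 Ce' Ct];
  congr C; apply/matrixP => i j; rewrite !mxE; field; rewrite gt_eqF//.
Qed.

(* Minkowski's theorem: induction on the dimension of the minimal face of x;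
   a maximal chord of C through x ends in two strictly smaller faces. *)
Lemma convex_hull_ext C S : closed C -> (exists M, forall x, C x -> dotp x x <= M) ->
  convex_set C -> convex_set S -> ext C `<=` S -> C `<=` S.
Proof.
move=> clC bC cC cS extS x.
have [U] : exists U : {vspace 'cV[R]_n}, forall d, face_directions C x d -> d \in U.
  by exists fullv => d _; exact: memvf.
have [k] := ubnP (\dim U).
elim: k x U => // k IH x U; rewrite ltnS => Uk xU Cx.
have [D0|] := pselect (forall d, face_directions C x d -> d = 0).
  apply/extS/ext_intro => // d e e0 Ce Ce'; apply: D0; exists e => //.
move=> /existsNP[d /not_implyP[[e e0 [Ce Ce']] /eqP d0]].
have dU : d \in U by apply: xU; exists e.
(* The induction hypothesis is applied at the last point of [C] along [r *: d]; [r] will be 1 and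
   -1. *)
have step r : r != 0 -> (exists2 t, 0 < t & C (x - t *: (r *: d))) ->
    exists s, [/\ 0 <= s, forall t, C (x + t *: (r *: d)) -> t <= s &
                  S (x + s *: (r *: d))].
  move=> r0 [t t0 Ct].
  have rd0 : r *: d != 0 by rewrite scaler_eq0 negb_or r0.
  have [s [s0 Cs smax]] := farthest_point clC bC rd0 Cx.
  exists s; split => //.
  have D'0 : face_directions C (x + s *: (r *: d)) 0.
    by exists 1 => //; rewrite scaler0 subr0 addr0.
  have [U' U'E] := linear_closed_vspace D'0
    (fun a u v => @face_directions_lin C (x + s *: (r *: d)) a u v cC).
  apply: (IH _ U') => // [|v /U'E//].
  apply: leq_trans Uk; rewrite ltnNge; apply/negP => Uk.
  have UU' : (U' <= U)%VS.
    by apply/subvP => v /U'E /(face_directions_sub cC s0 t0 Ct); exact: xU.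
  (* Equal dimensions would put [r *: d] among the directions at the exit point and prolong the
     chord beyond [s]. *)
  have /eqP UE : U' == U by rewrite eqEdim UU'.
  move: dU; rewrite -UE => /(memvZ r) /U'E[e' e'0 [Ce'' _]].
  have := smax (s + e'); rewrite scalerDl addrA => /(_ Ce''); lra.
have [|s [s0 smax Ss]] := step 1 (oner_neq0 _).
  by exists e; rewrite ?scale1r.
have [||t [t0 tmax St]] := step (-1).
- by rewrite oppr_eq0 oner_neq0.
- by exists e; rewrite // scaleN1r scalerN opprK.
have se : e <= s by apply: smax; rewrite scale1r.
have te : e <= t by apply: tmax; rewrite scaleN1r scalerN.
have st0 : 0 < t + s by lra.
have := convex_combination cS t0 s0 st0 Ss St; congr S.
by apply/matrixP => i j; rewrite !mxE; field; rewrite gt_eqF.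
Qed.

(** * Nearest points, separation and polars *)

Lemma nearest_point C x : closed C -> convex_set C -> C !=set0 ->
  exists2 p, C p & forall y, C y -> dotp (x - p) (y - p) <= 0.
Proof.
move=> clC cC C0.
have sc : continuous (fun v : 'cV[R]_n => x + v).
  apply: continuous_mx => i j.
  rewrite (_ : (fun _ => _) = fun v : 'cV[R]_n => x i j + v i j).
    by move=> v; exact: (cvgD (cvg_cst _) (@coord_continuous R n 1 i j v)).
  by apply/funext => v; rewrite mxE.
have [] := @closed_minimizer R n (fun v => dotp v v) ((fun v => x + v) @^-1` C).
- move=> c; apply: (@closed_preimage _ _ (fun v : 'cV[R]_n => dotp v v) [set r | r <= c]).
    exact: normsq_continuous.
  exact: closed_le.
- by [].
- exact: closed_preimage.
- by case: C0 => y Cy; exists (y - x); rewrite /= addrC subrK.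
move=> v /= Cv vmin; exists (x + v) => // y Cy.
have [w wE] : exists w, y - (x + v) = w by eexists.
rewrite wE opprD addrA subrr add0r dotpNl oppr_le0.
rewrite leNgt; apply/negP => vw0.
have w0 : 0 < dotp w w.
  rewrite lt_neqAle dotp_ge0 andbT; apply/eqP => /esym/dotp_eq0 w0.
  by move: vw0; rewrite w0 dotp0r ltxx.
(* [t] minimizes the norm of [v + t *: w] over [0, 1], which contradicts the choice of [v]. *)
pose t := Order.min 1 (- dotp v w / dotp w w).
have t0 : 0 < t by rewrite lt_min ltr01 divr_gt0// oppr_gt0.
have tw : t * dotp w w <= - dotp v w by rewrite -ler_pdivlMr// ge_min lexx orbT.
have := vmin (v + t *: w); rewrite /= !dotpE (dotpC w v).
have -> : x + (v + t *: w) = t *: y + (1 - t) *: (x + v).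
  by rewrite -wE; apply/matrixP => i j; rewrite !mxE; ring.
suff h : C (t *: y + (1 - t) *: (x + v)) by move=> /(_ h); nra.
by move/convex_setP: cC; apply => //; rewrite ltW//= ge_min lexx.
Qed.

Lemma bipolar_sub C x : closed C -> convex_set C -> C 0 ->
  (forall y, polar C y -> dotp x y <= 1) -> C x.
Proof.
move=> clC cC C0 xpol; have [|p Cp xp] := nearest_point x clC cC; first by exists 0.
pose v := x - p; have xE : x = v + p by rewrite subrK.
suff /dotp_eq0 v0 : dotp v v = 0 by rewrite xE v0 add0r.
apply/eqP; rewrite eq_le dotp_ge0 andbT leNgt; apply/negP => v0.
have vp0 : 0 <= dotp v p by have := xp 0 C0; rewrite sub0r dotpNr oppr_le0.
(* [b] lies strictly between [dotp v p], the maximum of [dotp v] on [C], and [dotp v x], so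
   [b^-1 *: v] is in the polar but exceeds 1 at [x]. *)
pose b := dotp v p + dotp v v / 2.
have b0 : 0 < b by rewrite /b; lra.
have : dotp x (b^-1 *: v) <= 1.
  apply: xpol => y Cy; rewrite dotpZr mulrC ler_pdivrMr// mul1r dotpC /b.
  have := xp y Cy; rewrite -/v dotpDr dotpNr; lra.
rewrite dotpZr mulrC ler_pdivrMr// mul1r xE dotpDl (dotpC p) /b; lra.
Qed.

Lemma closed_polar C : closed (polar C).
Proof.
have -> : polar C = \bigcap_(x in C) [set y | dotp x y <= 1] by [].
apply: closed_bigI => x _.
have -> : [set y | dotp x y <= 1] = (fun y => dotp y x) @^-1` [set r | r <= 1].
  by apply/seteqP; split => y /=; rewrite dotpC.
by apply: closed_preimage; [exact: dotp_continuous | exact: closed_le].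
Qed.

Lemma convex_halfspace x (c : R) : convex_set [set y | dotp x y <= c].
Proof.
apply/convex_setP => a b t /= ac bc /andP[t0 t1]; rewrite dotpDr !dotpZr.
nra.
Qed.

Lemma convex_hyperplane x (c : R) : convex_set [set y | dotp x y = c].
Proof.
apply/convex_setP => a b t /= ac bc _; rewrite dotpDr !dotpZr ac bc; ring.
Qed.

Lemma convex_polar C : convex_set (polar C).
Proof.
apply/convex_setP => a b t Ca Cb t01 x Cx.
by move/convex_setP: (@convex_halfspace x 1); apply => //; [exact: Ca|exact: Cb].
Qed.

Section ConvexBody.
Variables (C : set 'cV[R]_n) (hC : convex_body C).

Lemma convex_body_closed : closed C.
Proof. by case: hC => cC _ _; exact: compact_closed. Qed.

Lemma convex_body_bounded : exists M, forall x, C x -> dotp x x <= M.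
Proof.
case: hC => cC _ _.
have /compact_bounded[M [_ MC]] : compact [set dotp x x | x in C].
  by apply: continuous_compact => //; exact/continuous_subspaceT/normsq_continuous.
exists (M + 1) => x Cx; apply: le_trans (ler_norm _) _.
by apply: MC; [rewrite ltrDl|exists x].
Qed.

Lemma convex_body0 : C 0.
Proof. by case: hC => _ _; exact: interior_subset. Qed.

(** As the origin is interior, [C] contains small multiples of plus and minus each basis vector;
    these bound the coordinates. *)
Lemma convex_body_polar_bounded : exists M, forall y, polar C y -> dotp y y <= M.
Proof.
case: hC => _ cC iC.
pose t i := projT1 (cid2 (interior_directions (delta_mx i 0) cC iC)).
have tP i : 0 < t i /\ forall y, polar C y -> y i 0 ^+ 2 <= ((t i)^-1) ^+ 2.
  rewrite /t; case: cid2 => /= r r0 [Cr Cr']; split => // y Cy.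
  have := Cy _ Cr; have := Cy _ Cr'.
  rewrite !add0r dotpNl !dotpZl !(dotpC _ y) dotp_delta => h1 h2.
  rewrite -(@real_normK _ (y i 0)) ?num_real// lerXn2r ?nnegrE ?invr_ge0 ?(ltW r0)//.
  rewrite -[leRHS]mul1r ler_pdivlMr// mulrC -(gtr0_norm r0) -normrM ler_norml.
  by apply/andP; split; lra.
exists (\sum_i ((t i)^-1) ^+ 2) => y Cy; apply: ler_sum => i _.
by rewrite -expr2; exact: (tP i).2.
Qed.

(** Minkowski's theorem applies to the polar, which is closed and bounded; it reduces convex
    conditions to extreme points. *)
Lemma sub_ext_polar (S : set 'cV[R]_n) :
  convex_set S -> ext (polar C) `<=` S -> polar C `<=` S.
Proof.
move=> cS; apply: convex_hull_ext => //; first exact: closed_polar.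
  exact: convex_body_polar_bounded.
exact: convex_polar.
Qed.

Lemma ext_polar_sep x : (forall y, ext (polar C) y -> dotp x y <= 1) -> C x.
Proof.
move=> xext; apply: bipolar_sub.
- exact: convex_body_closed.
- by case: hC.
- exact: convex_body0.
- apply: sub_ext_polar => //; exact: convex_halfspace.
Qed.

(** The equality spreads to the whole polar; the origin gives [s = 0], and then every multiple of
    [x] lies in the bounded set [C]. *)
Lemma dotp_ext_polar_const x (s : R) :
  (forall y, ext (polar C) y -> dotp x y = s) -> s = 0 /\ x = 0.
Proof.
move=> xs; have xpol : polar C `<=` [set y | dotp x y = s].
  by apply: sub_ext_polar => //; exact: convex_hyperplane.
have s0 : s = 0.
  have : [set y | dotp x y = s] 0 by apply: xpol => y _; rewrite dotp0r ler01.
  by rewrite /= dotp0r.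
split => //; subst s; have [M CM] := convex_body_bounded.
have CtX (t : R) : C (t *: x).
  by apply: ext_polar_sep => y /xs; rewrite dotpZl => ->; rewrite mulr0 ler01.
apply: dotp_eq0; apply/eqP; rewrite eq_le dotp_ge0 andbT leNgt; apply/negP => x0.
have M0 : 0 <= M by have := CM _ (CtX 0); rewrite scale0r dotp0r.
pose t := M / dotp x x + 1.
have t1 : 1 <= t by rewrite lerDr divr_ge0// ltW.
have tx : t * dotp x x = M + dotp x x by rewrite mulrDl divfK ?gt_eqF// mul1r.
have := CM _ (CtX t); rewrite dotpZl dotpZr tx; nra.
Qed.

End ConvexBody.

(** * Convex cones and the M. Riesz extension theorem *)

Lemma cone_add K u v : closed_convex_cone K -> K u -> K v -> K (u + v).
Proof.
move=> [_ cK _ sK] Ku Kv.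
have := convex_combination cK ler01 ler01 (addr_gt0 ltr01 ltr01) Ku Kv.
move=> /(sK (1 + 1) _ (addr_ge0 ler01 ler01)).
by rewrite !scale1r scalerA mulfV ?scale1r// gt_eqF// addr_gt0.
Qed.

(** Induction on the codimension of [M]: each step adjoins a vector [v] and picks a value there that
    preserves positivity. *)
Lemma riesz_extension K (M : {vspace 'cV[R]_n}) e b :
  closed_convex_cone K -> interior K e -> e \in M ->
  (forall w, K w -> w \in M -> 0 <= dotp w b) ->
  exists2 b', dual_cone K b' & forall w, w \in M -> dotp w b' = dotp w b.
Proof.
move=> hK Ke; have [_ _ _ sK] := hK.
have [k] := ubnP (\dim {:'cV[R]_n} - \dim M)%N; elim: k M b => // k IH M b.
rewrite ltnS => Mk eM bM.
have [MT|/subvPn[v _ vM]] := boolP (fullv <= M)%VS.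
  by exists b => // w Kw; apply: bM => //; exact/(subvP MT)/memvf.
have [y My vy] := vspace_sep vM.
(* [I] collects the lower bounds that positivity at [a + v] puts on the value at [v]; by [Ile], they
   stay below the upper bounds coming from [c - v]. *)
pose I := [set - dotp a b | a in [set a | a \in M /\ K (a + v)]].
(* The interior point [e] in [M] makes every vector a sum from [K] and [M], so bounds of both kinds
   exist. *)
have shift d : exists2 a, a \in M & K (a + d).
  have [t t0 Kt] := interior_direction d Ke.
  exists (t^-1 *: e); first exact: memvZ.
  have := sK t^-1 _ _ Kt; rewrite scalerDr scalerA mulVf ?gt_eqF// scale1r.
  by apply; rewrite invr_ge0 ltW.
have Ile c : c \in M -> K (c - v) -> forall r, I r -> r <= dotp c b.
  move=> cM Kc _ [a [aM Ka] <-]; rewrite lerNl -subr_ge0 opprK -dotpDl.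
  apply: bM; last exact: memvD.
  by have := cone_add hK Ka Kc; rewrite addrACA subrr addr0 addrC.
have [a0 a0M Ka0] := shift v; have [c0 c0M Kc0] := shift (- v).
have I0 : I !=set0 by exists (- dotp a0 b); exists a0.
have sI : has_sup I by split => //; exists (dotp c0 b) => r; exact: Ile.
pose s := sup I; pose b' := b + (s - dotp v b) *: y.
have b'M w : w \in M -> dotp w b' = dotp w b.
  by move=> wM; rewrite dotpDr dotpZr (My _ wM) mulr0 addr0.
have b'v : dotp v b' = s by rewrite dotpDr dotpZr vy mulr1 addrC subrK.
have MvM : (\dim M < \dim (M + <[v]>))%N.
  rewrite ltnNge; apply/negP => dM.
  have /eqP ME : M == (M + <[v]>)%VS by rewrite eqEdim addvSl.
  by move: vM; rewrite ME (subvP (addvSr _ _)) ?memv_line.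
have [|||b'' Kb'' b''M] := IH (M + <[v]>)%VS b'.
- apply: leq_trans Mk; apply: ltn_sub2l => //.
  exact: leq_trans MvM (dimvS (subvf _)).
- exact: (subvP (addvSl _ _)).
- move=> w Kw /memv_addP[a aM [_ /vlineP[t ->] wE]]; rewrite wE in Kw *.
  (* For nonzero [t], dividing by its absolute value turns [w] into some [a + v] or [a - v], and the
     claim into a bound on [s]. *)
  rewrite dotpDl dotpZl b'v b'M//; have [t0|t0|t0] := ltrgt0P t; last first.
  + by rewrite t0 mul0r addr0; apply: bM => //; move: Kw; rewrite t0 scale0r addr0.
  + have : s <= dotp ((- t)^-1 *: a) b.
      apply: ge_sup => //; apply: Ile; first exact: memvZ.
      have := sK (- t)^-1 _ _ Kw; rewrite scalerDr scalerA invrN mulNr.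
      rewrite mulVf ?lt_eqF// scaleN1r; apply.
      by rewrite oppr_ge0 invr_le0 ltW.
    by rewrite dotpZl mulrC ler_pdivlMr ?oppr_gt0//; lra.
  + have : - dotp (t^-1 *: a) b <= s.
      apply: sup_upper_bound => //; exists (t^-1 *: a) => //; split; first exact: memvZ.
      have := sK t^-1 _ _ Kw; rewrite scalerDr scalerA mulVf ?gt_eqF// scale1r.
      by apply; rewrite invr_ge0 ltW.
    by rewrite dotpZl lerNl mulrC ler_pdivlMr//; lra.
- exists b'' => // w wM; rewrite b''M ?b'M//.
  exact: (subvP (addvSl _ _)).
Qed.

End Convexity.

(** * Lifts and factorizations *)

Section Lifts.
Variables (R : realType) (n m : nat).
Variables (K : set 'cV[R]_m) (C : set 'cV[R]_n).
Variables (G : set 'M[R]_n) (H : set 'M[R]_m).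
Hypotheses (hC : convex_body C) (hG : matrix_group G) (hH : matrix_group H).

Lemma group_hom1 f : group_hom G H f -> f 1%:M = 1%:M.
Proof.
case: hG => _ G1 _ _; case: hH => uH _ _ _ [fH fM].
have := fM _ _ G1 G1; rewrite mul1mx => /(congr1 (mulmx (invmx (f 1%:M)))).
by rewrite mulmxA mulVmx ?uH ?mul1mx//; exact: fH.
Qed.

Lemma ext_image_stable g x : acts_on G (ext C) -> G g -> ext C x -> ext C (g *m x).
Proof. by move=> act Gg Cx; rewrite -(act g Gg); exists x. Qed.

Lemma affine_subspaceP (p : 'cV[R]_m) (S : set 'cV[R]_m) : S 0 ->
  (forall a u v, S u -> S v -> S (a *: u + v)) ->
  affine_subspace [set w | S (w - p)].
Proof.
move=> S0 Slin; have [U UE] := linear_closed_vspace S0 Slin.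
exists p, U; apply/seteqP; split => [w /= /UE wU|_ [u /= /UE uS <-] /=].
  by exists (w - p); rewrite //= addrC subrK.
by rewrite addrC addKr.
Qed.

(** * From a factorization to a lift *)

Section FactorizationToLift.
Variables (A : 'cV[R]_n -> 'cV[R]_m) (B : 'cV[R]_n -> 'cV[R]_m).
Hypothesis AB : is_factorization C K A B.

Lemma ext_convex_body_neq0 : ext C !=set0.
Proof.
apply/set0P/negP => /eqP C0; suff : set0 (0 : 'cV[R]_n) by [].
have [_ cC _] := hC; apply: (convex_hull_ext _ _ cC _ _ (convex_body0 hC)).
- exact: convex_body_closed.
- exact: convex_body_bounded.
- by apply/convex_setP.
- by rewrite C0.
Qed.

(* Slack values determine x, so A x |-> x and A x |-> 1 extend linearly to the
   span of A (ext C). *)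
Lemma factorization_linear : exists (X : seq 'cV[R]_m) (P : 'M[R]_(n, m)) l,
  [/\ forall w, w \in X -> exists2 x, ext C x & w = A x,
      forall x, ext C x -> A x \in <<X>>%VS,
      forall x, ext C x -> P *m A x = x,
      forall x, ext C x -> dotp (A x) l = 1 &
      forall w y, w \in <<X>>%VS -> ext (polar C) y ->
        dotp w (B y) = dotp w l - dotp (P *m w) y].
Proof.
case: AB => _ _ slackE.
have [X [fX XA AX]] := free_spanning (A @` ext C).
have /choice[h hP] : forall w, exists x, w \in X -> ext C x /\ A x = w.
  move=> w; have [/XA[x Cx xw]|wX] := boolP (w \in X); last by exists 0.
  by exists x.
have [P PX] := mulmx_ext_free h fX.
have [Q QX] := mulmx_ext_free (fun=> 1 : 'cV[R]_1) fX.
have QE w : dotp w Q^T = (Q *m w) 0 0.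
  by rewrite mxE; apply: eq_bigr => i _; rewrite mxE mulrC.
(* Both sides are linear in [w], so they need comparing only on [X], where this is the slack
   identity. *)
have BE w y : w \in <<X>>%VS -> ext (polar C) y ->
    dotp w (B y) = dotp w Q^T - dotp (P *m w) y.
  move=> + Cy; move: w; apply: span_ind => [|a u v|w wX] /=.
  - by rewrite mulmx0 !dotp0l subr0.
  - by rewrite mulmxDr -scalemxAr !dotpE => -> ->; ring.
  - have [Cx Aw] := hP w wX; rewrite -{1}Aw -slackE// QE QX// PX// mxE eqxx.
    by [].
(* Comparing [BE] with the slack identity at [A x] shows that [P *m A x - x] has the same product,
   [dotp (A x) Q^T - 1], with all extreme points of the polar. *)
have key x : ext C x -> dotp (A x) Q^T - 1 = 0 /\ P *m A x - x = 0.
  move=> Cx; apply: (dotp_ext_polar_const hC) => y Cy.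
  have /AX /BE /(_ Cy) : (A @` ext C) (A x) by exists x.
  by rewrite -slackE// /slack dotpDl dotpNl; lra.
exists X, P, Q^T; split => //.
- by move=> w /XA[x Cx <-]; exists x.
- by move=> x Cx; apply: AX; exists x.
- by move=> x /key[_ /eqP]; rewrite subr_eq0 => /eqP.
- by move=> x /key[/eqP]; rewrite subr_eq0 => /eqP.
Qed.

Lemma factorization_lift f : convex_set K ->
  acts_on G (ext C) -> acts_on H K -> group_hom G H f ->
  (forall g, G g -> forall x, ext C x -> A (g *m x) = f g *m A x) ->
  exists L P, is_lift C K L P /\ forall g, G g ->
    [set f g *m w | w in K `&` L] = K `&` L /\
    forall w, (K `&` L) w -> ext C (P *m w) -> P *m (f g *m w) = g *m (P *m w).
Proof.
move=> /convex_setP cK actG actH fhom fA.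
have [X [P [l [XA AX PA lA BE]]]] := factorization_linear.
case: AB => KA dB _.
have [x0 Cx0] := ext_convex_body_neq0.
(* The condition [dotp w l = 1] cuts the affine span of the points [A x] out of their linear
   span. *)
pose L := [set w : 'cV[R]_m | w \in <<X>>%VS /\ dotp w l = 1].
(* All three claims are linear in [w] and hold at [A x], which [f g] sends to [A (g *m x)]. *)
have stable g w : G g -> w \in <<X>>%VS ->
    [/\ f g *m w \in <<X>>%VS, P *m (f g *m w) = g *m (P *m w) &
        dotp (f g *m w) l = dotp w l].
  move=> Gg; move: w; apply: span_ind => [|a u v [uX uP ul] [vX vP vl]|w wX] /=.
  - by rewrite !mulmx0 mem0v dotp0l.
  - rewrite !mulmxDr -!scalemxAr !dotpE uP ul vP vl; split=> //.
    by rewrite memvD ?memvZ.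
  - have [x Cx ->] := XA w wX; rewrite -fA//.
    have Cgx := ext_image_stable actG Gg Cx.
    by rewrite AX// !PA// !lA.
have sub g w : G g -> (K `&` L) w -> (K `&` L) (f g *m w).
  move=> Gg [Kw [wX wl]]; have [gwX _ gwl] := stable g w Gg wX.
  split; last by split=> //; rewrite gwl.
  by rewrite -(actH (f g)); [exists w | exact: fhom.1].
exists L, P; split; first split.
- suff -> : L = [set w | w - A x0 \in <<X>>%VS /\ dotp (w - A x0) l = 0].
    apply: (@affine_subspaceP (A x0)
      [set u | u \in <<X>>%VS /\ dotp u l = 0]) => /=.
      by rewrite mem0v dotp0l.
    move=> a u v [uX ul] [vX vl]; rewrite !dotpE ul vl mulr0 addr0; split=> //.
    by rewrite memvD ?memvZ.
  apply/seteqP; split => w /= [wX wl].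
    by rewrite memvB ?AX// dotpDl dotpNl lA// wl subrr.
  split; first by rewrite -(subrK (A x0) w) memvD ?AX.
  by rewrite -(subrK (A x0) w) dotpDl wl lA// add0r.
- apply/seteqP; split => [|_ [w [Kw [wX wl]] <-]]; last first.
    (* On [L], nonnegativity of [dotp w (B y)] reads [dotp (P *m w) y <= 1], and these inequalities
       cut out [C]. *)
    apply: (ext_polar_sep hC) => y Cy.
    have := dB y Cy w Kw; rewrite BE// wl; lra.
  have [_ cC _] := hC; apply: (convex_hull_ext _ _ cC).
  + exact: convex_body_closed.
  + exact: convex_body_bounded.
  + apply/convex_setP => _ _ t [u [Ku [uX ul]] <-] [v [Kv [vX vl]] <-] t01.
    exists (t *: u + (1 - t) *: v); last by rewrite mulmxDr -!scalemxAr.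
    split; first exact: cK.
    by split; [rewrite memvD ?memvZ | rewrite !dotpE ul vl; ring].
  + move=> x Cx; exists (A x); last exact: PA.
    by split; [exact: KA | split; [exact: AX | exact: lA]].
- move=> g Gg; split; last by move=> w [_ [wX _]] _; have [] := stable g w Gg wX.
  apply/seteqP; split => [_ [w KLw <-]|w KLw]; first exact: sub.
  have [uG _ _ GV] := hG; exists (f (invmx g) *m w).
    by apply: sub => //; exact: GV.
  rewrite mulmxA -fhom.2//; last exact: GV.
  by rewrite mulmxV ?uG// (group_hom1 fhom) mul1mx.
Qed.

End FactorizationToLift.

(** * From a proper lift to a factorization *)

Section LiftToFactorization.
Variables (L : set 'cV[R]_m) (P : 'M[R]_(n, m)).
Hypotheses (hn : (0 < n)%N) (hK : closed_convex_cone K).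
Hypotheses (CKL : is_lift C K L P) (pKL : proper_lift K L).

(** Positive dimension and an interior origin give distinct points, so [P] cannot be constant on
    [L]. *)
Lemma lift_nonconstant : exists u v, [/\ C u, C v & u <> v].
Proof.
have [_ _ iC] := hC; exists 0.
have [t t0] := interior_direction (const_mx 1) iC; rewrite add0r => Ct.
exists (t *: const_mx 1); split=> //; first exact: convex_body0.
move/matrixP => /(_ (Ordinal hn) 0); rewrite !mxE mulr1 => t00.
by move: t0; rewrite -t00 ltxx.
Qed.

(* A recession direction of K inside the direction space U of L must be killed
   by P, as C is bounded. *)
Lemma lift_slack_vector y : polar C y -> exists2 b, dual_cone K b &
  forall w, (K `&` L) w -> dotp w b = slack (P *m w) y.
Proof.
move=> Cy; have [clK cK K0 sK] := hK.
have [[p [U LE]] CE] := CKL; have [e [Le Ke]] := pKL.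
have KLC w : (K `&` L) w -> C (P *m w) by move=> KLw; rewrite CE; exists w.
have LU w : L w <-> w - p \in U.
  rewrite LE; split=> [[u /= uU <-]|wU]; first by rewrite addrC addKr.
  by exists (w - p); rewrite //= addrC subrK.
have LB w w' : L w -> L w' -> w - w' \in U.
  move=> /LU wU /LU wU'; rewrite -(subrKA p w (- w')) memvD//.
  by rewrite -opprB memvN.
have LD w u t : L w -> u \in U -> L (w + t *: u).
  by move=> /LU wU uU; apply/LU; rewrite addrAC memvD ?memvZ.
have Ke0 := interior_subset Ke.
have rec u : K u -> u \in U -> P *m u = 0.
  move=> Ku uU; have [M CM] := convex_body_bounded hC.
  apply: dotp_eq0; apply/eqP; rewrite eq_le dotp_ge0 andbT leNgt.
  apply/negP => Pu0.
  pose a := dotp (P *m e) (P *m u).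
  pose D := dotp (P *m u) (P *m u); rewrite -/D in Pu0.
  have M0 : 0 <= M by apply: le_trans (CM _ (convex_body0 hC)); exact: dotp_ge0.
  (* With this [t], the quadratic term [t ^+ 2 * D] pushes the squared norm of [P *m (e + t *: u)]
     beyond [M]. *)
  pose t := (M + 2 * `|a|) / D + 1.
  have na : 0 <= `|a| by [].
  have t1 : 1 <= t by rewrite lerDr divr_ge0 ?(ltW Pu0)//; lra.
  have KLt : (K `&` L) (e + t *: u).
    split; last exact: LD.
    by apply: cone_add => //; apply: sK => //; lra.
  have := CM _ (KLC _ KLt); rewrite mulmxDr -scalemxAr !dotpE.
  rewrite (dotpC (P *m u) (P *m e)) -/a -/D.
  have tD : t * D = M + 2 * `|a| + D by rewrite mulrDl divfK ?gt_eqF// mul1r.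
  have na' : 0 <= t * (`|a| + a).
    apply: mulr_ge0; first by lra.
    by rewrite -lerBlDr sub0r -normrN ler_norm.
  have tMD : 1 * (M + D) <= t * (M + D) by rewrite ler_wpM2r//; lra.
  have := dotp_ge0 (P *m e); rewrite tD; lra.
(* If [d] were in [U], every direction of [U] would be a multiple of a difference of recession
   directions, so [P] would vanish on [U] and [C] would be a point. *)
have noint d : K d -> (forall v, exists2 t, 0 < t & K (d + t *: v)) ->
    d \notin U.
  move=> Kd int; apply/negP => dU.
  have PU u : u \in U -> P *m u = 0.
    move=> uU; have [t t0 Kt] := int u.
    have := rec _ Kt; rewrite mulmxDr (rec d)// add0r memvD ?memvZ//.
    rewrite -scalemxAr => /(_ isT) /eqP; rewrite scaler_eq0 gt_eqF//=.
    by move/eqP.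
  have [u [v [+ + []]]] := lift_nonconstant; rewrite {1 2}CE.
  move=> [w [_ Lw] <-] [w' [_ Lw'] <-].
  by apply/eqP; rewrite -subr_eq0 -mulmxBr PU ?LB.
have eU : e \notin U by apply: noint => // v; exact: interior_direction.
have [l lU le] := vspace_sep eU.
have lL w : L w -> dotp w l = 1.
  by move=> Lw; rewrite -le -[w](subrK e) dotpDl lU ?add0r ?LB.
(* [b0] homogenizes the slack: [dotp w l] replaces the constant 1, which it equals on [L]. *)
pose b0 := l - P^T *m y.
have b0E w : dotp w b0 = dotp w l - dotp (P *m w) y.
  by rewrite dotpDr dotpNr dotp_mulmxl.
(* This subspace is the linear span of [L], and it contains the interior point [e]. *)
have [||b Kb bE] :=
  riesz_extension (M := (U + <[e]>)%VS) (b := b0) hK Ke.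
- exact: (subvP (addvSr _ _) _ (memv_line _)).
- move=> w Kw /memv_addP[u uU [_ /vlineP[t ->] wE]].
  rewrite b0E; rewrite wE in Kw *.
  rewrite dotpDl dotpZl lU// le add0r mulr1 mulmxDr -scalemxAr dotpDl dotpZl.
  (* Positive [t] rescales [w] into [L]; negative [t] would put an interior point of [K] in [U]; for
     [t = 0], [w] is a recession direction. *)
  have [t0|t0|t0] := ltrgt0P t.
  + have : C (P *m (t^-1 *: (u + t *: e))).
      apply: KLC; split; first by apply: sK; rewrite ?invr_ge0 ?ltW.
      rewrite scalerDr scalerA mulVf ?gt_eqF// scale1r addrC.
      exact: LD.
    move=> /Cy; rewrite -scalemxAr mulmxDr -scalemxAr dotpZl dotpDl dotpZl.
    by rewrite mulrC ler_pdivrMr// mul1r subr_ge0.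
  + have /negP[] : (- t)^-1 *: u \notin U.
      have Kd : K ((- t)^-1 *: u - e).
        have := sK (- t)^-1 _ _ Kw; rewrite scalerDr scalerA invrN mulNr.
        rewrite mulVf ?lt_eqF// scaleN1r; apply.
        by rewrite oppr_ge0 invr_le0 ltW.
      apply: noint => [|v].
        by rewrite -[_ *: u](subrK e); exact: cone_add.
      have [s s0 Ks] := interior_direction v Ke; exists s => //.
      by rewrite -[_ *: u](subrK e) -addrA; exact: cone_add.
    exact: memvZ.
  + rewrite t0 scale0r addr0 in Kw.
    by rewrite (rec u)// t0 dotp0l mul0r addr0 subr0.
- exists b => // w [Kw Lw]; rewrite bE ?b0E ?lL//.
  by rewrite -[w](subrK e) memv_add ?memv_line ?LB.
Qed.

(** By [vspace_sep], the vectors orthogonal to the direction space cut [L] out by hyperplanes. *)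
Lemma affine_subspace_closed : affine_subspace L -> closed L.
Proof.
move=> [p [U ->]].
have -> : [set p + u | u in [set` U]] =
    \bigcap_(y in [set y | forall u, u \in U -> dotp u y = 0])
      [set w | dotp w y = dotp p y].
  apply/seteqP; split => [_ [u uU <-] y Uy /=|w wU].
    by rewrite dotpDl (Uy u uU) addr0.
  exists (w - p); last by rewrite addrC subrK.
  apply/negPn/negP => /vspace_sep[y Uy]; rewrite dotpDl dotpNl (wU y Uy) subrr.
  by move/eqP; rewrite eq_sym oner_eq0.
apply: closed_bigI => y _.
exact: closed_preimage (@dotp_continuous _ _ y) (@closed_eq _ (dotp p y)).
Qed.

(* A x is the point of least gauge in the fiber of x, for a gauge invariant
   under f @` G: equivariance follows from uniqueness. *)
Lemma lift_equivariant_section f : compact G -> acts_on G (ext C) ->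
  continuous_group_hom G H f ->
  (forall g, G g ->
    [set f g *m w | w in K `&` L] = K `&` L /\
    forall w, (K `&` L) w -> ext C (P *m w) -> P *m (f g *m w) = g *m (P *m w)) ->
  exists A : 'cV[R]_n -> 'cV[R]_m,
    (forall x, ext C x -> (K `&` L) (A x) /\ P *m A x = x) /\
    forall g, G g -> forall x, ext C x -> A (g *m x) = f g *m A x.
Proof.
move=> cG actG [fhom fcont] fsym.
have [uG G1 GM GV] := hG; have [uH _ _ _] := hH.
have [clK cK _ _] := hK; have [aL CE] := CKL.
pose E := f @` G; pose F x := (K `&` L) `&` [set w | P *m w = x].
have E1 : E 1%:M by exists 1%:M => //; exact: group_hom1.
have cE : compact E by exact: continuous_compact.
have uE M : E M -> M \in unitmx by move=> [g Gg <-]; apply: uH; exact: fhom.1.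
have clF x : closed (F x).
  apply: closedI; first by apply: closedI => //; exact: affine_subspace_closed.
  have -> : [set w | P *m w = x] =
      \bigcap_(i in setT) [set w | dotp w (P^T *m delta_mx i 0) = x i 0].
    apply/seteqP; split => [w /= <- i _ /=|w wx /=].
      by rewrite -dotp_mulmxl dotp_delta.
    by apply/colP => i; have := wx i I; rewrite /= -dotp_mulmxl dotp_delta.
  apply: closed_bigI => i _.
  exact: closed_preimage (@dotp_continuous _ _ _) (@closed_eq _ (x i 0)).
have F0 x : ext C x -> F x !=set0.
  by move=> [+ _]; rewrite {1}CE => -[w KLw wx]; exists w.
have /choice[A AP] : forall x, exists w, ext C x ->
    F x w /\ forall v, F x v -> gauge E w <= gauge E v.
  move=> x; have [Cx|nCx] := pselect (ext C x); last by exists 0.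
  by have [w Fw wmin] := gauge_argmin E1 cE (clF x) (F0 x Cx); exists w.
have fF g x w : G g -> ext C x -> F x w -> F (g *m x) (f g *m w).
  move=> Gg Cx [KLw /= wx]; have [gKL gP] := fsym g Gg; split.
    by rewrite -gKL; exists w.
  by rewrite /= gP// wx.
(* Right multiplication by [g] maps [G] into itself, so the supremum for [f g *m w] runs over part
   of the family for [w]. *)
have gauge_f g w : G g -> gauge E (f g *m w) <= gauge E w.
  move=> Gg; apply/gauge_le => // M [h Gh <-].
  rewrite mulmxA -fhom.2//; apply: gauge_ub => //.
  by exists (h *m g) => //; exact: GM.
have gmidF x v w : F x v -> F x w -> F x (2^-1 *: (v + w)).
  move=> [[Kv Lv] /= vx] [[Kw Lw] /= wx]; split; first split.
  - have := convex_combination cK ler01 ler01 (addr_gt0 ltr01 ltr01) Kv Kw.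
    by rewrite !scale1r.
  - move: aL => [p [U LE]]; move: Lv Lw; rewrite LE => -[u uU <-] [u' u'U <-].
    exists (2^-1 *: (u + u')); first by rewrite /= memvZ ?memvD.
    by apply/matrixP => i j; rewrite !mxE; field.
  - rewrite /= -scalemxAr mulmxDr vx wx.
    by apply/matrixP => i j; rewrite !mxE; field.
exists A; split => [x /AP[[KL Px] _] //|g Gg x Cx].
have Cgx := ext_image_stable actG Gg Cx.
have [Fgx gxmin] := AP _ Cgx; have [Fx xmin] := AP _ Cx.
have Fgx' := fF _ _ _ Gg Cx Fx.
(* A competitor [u] over [g *m x] is carried to the fiber over [x] by [f (invmx g)], and the gauge
   increases in neither direction. *)
apply: (gauge_argmin_uniq E1 cE uE (gmidF _ _ _ Fgx Fgx')) => u Fu.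
  exact: gxmin.
have GVg := GV _ Gg.
have Fu' : F x (f (invmx g) *m u).
  by have := fF _ _ _ GVg Cgx Fu; rewrite mulmxA mulVmx ?uG// mul1mx.
apply: (le_trans (gauge_f _ _ Gg)); apply: (le_trans (xmin _ Fu')).
exact: gauge_f.
Qed.

(** Symmetry constrains only [A], so each [B y] is chosen separately; its slack identity on [L] is
    evaluated at [A x]. *)
Lemma lift_factorization f : compact G -> acts_on G (ext C) ->
  continuous_group_hom G H f ->
  (forall g, G g ->
    [set f g *m w | w in K `&` L] = K `&` L /\
    forall w, (K `&` L) w -> ext C (P *m w) -> P *m (f g *m w) = g *m (P *m w)) ->
  exists A B, is_factorization C K A B /\
    forall g, G g -> forall x, ext C x -> A (g *m x) = f g *m A x.
Proof.
move=> cG actG fhom fsym.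
have [A [AKL Ag]] := lift_equivariant_section cG actG fhom fsym.
have /choice[B BP] : forall y, exists b, polar C y -> dual_cone K b /\
    forall w, (K `&` L) w -> dotp w b = slack (P *m w) y.
  move=> y; have [Cy|nCy] := pselect (polar C y); last by exists 0.
  by have [b] := lift_slack_vector Cy; exists b.
exists A, B; split => //; split => [x /AKL[[]]//|y [/BP[]]//|x y Cx [/BP[_ Bw] _]].
by have [KLx Px] := AKL x Cx; rewrite Bw// Px.
Qed.

End LiftToFactorization.

End Lifts.

Theorem theorem2p12 (R : realType) (n m : nat) (hn : (0 < n)%N)
  (K : set 'cV[R]_m) (hK : closed_convex_cone K) (hKfull : full_dimensional K)
  (C : set 'cV[R]_n) (hC : convex_body C)
  (G : set 'M[R]_n) (hG : matrix_group G) (hGcompact : compact G)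
  (hGC : acts_on G (ext C))
  (H : set 'M[R]_m) (hH : matrix_group H) (hHK : acts_on H K) :
  [/\ (exists L P, [/\ is_lift C K L P, proper_lift K L &
                       symmetric_lift (continuous_group_hom G H) G C K L P]) ->
      (exists A B, is_factorization C K A B /\
                   symmetric_factorization (continuous_group_hom G H) G C A),
      (exists A B, is_factorization C K A B /\
                   symmetric_factorization (group_hom G H) G C A) ->
      (exists L P, is_lift C K L P /\
                   symmetric_lift (group_hom G H) G C K L P) &
      (exists A B, is_factorization C K A B /\
                   symmetric_factorization (continuous_group_hom G H) G C A) ->
      (exists L P, is_lift C K L P /\
                   symmetric_lift (continuous_group_hom G H) G C K L P)].
Proof.
have [_ cK _ _] := hK.
split.
- move=> [L [P [lift proper [f fhom fsym]]]].
  have [A [B [fact Ag]]] := lift_factorization hC hG hH hn hK lift proper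
    hGcompact hGC fhom fsym.
  by exists A, B; split=> //; exists f.
- move=> [A [B [fact [f fhom fA]]]].
  have [L [P [lift sym]]] := factorization_lift hC hG hH fact cK hGC hHK fhom fA.
  by exists L, P; split=> //; exists f.
(* The lift is symmetric under the same [f], so continuity carries over. *)
- move=> [A [B [fact [f fhom fA]]]].
  have [L [P [lift sym]]] := factorization_lift hC hG hH fact cK hGC hHK fhom.1 fA.
  by exists L, P; split=> //; exists f.
Qed.
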